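(* Let $p=p(n)\in[0,1]$ and let $G_n(p)$ be the Erdős–Rényi random graph. Then almost every random graph $G_n(p)$ satisfies $$\mathscr{E}(G_n(p))=n^{3/2}\left(\frac{8}{3\pi}\sqrt{p(1-p)}+o(1)\right),$$ that is, $n^{-3/2}\mathscr{E}(G_n(p))-\frac{8}{3\pi}\sqrt{p(1-p)}\to 0$ in probability as $n\to\infty$.
   Context: For a simple graph $G$ of order $n$ with adjacency matrix eigenvalues $\lambda_1,\dots,\lambda_n$ (with multiplicity), the energy of $G$ is $\mathscr{E}(G)=\sum_{i=1}^n|\lambda_i|$. The random graph $G_n(p)$ has vertex set $[n]=\{1,\dots,n\}$, and each of the $\binom n2$ possible edges is present independently with probability $p=p(n)$. ''Almost every'' graph has a property if the probability that the random graph has the property tends to $1$ as $n\to\infty$; an asymptotic equality with $o(1)$ holding for almost every graph means that for each $\varepsilon>0$, with probability tending to $1$, the error term is at most $\varepsilon$ in absolute value. *)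

(* Defs.v *)
From HB Require Import structures.
From mathcomp Require Import all_boot all_order all_algebra.
From mathcomp Require Import complex.
From mathcomp Require Import all_classical all_reals all_analysis.
Set Implicit Arguments.
Unset Strict Implicit.
Unset Printing Implicit Defensive.
Import Order.TTheory GRing.Theory Num.Theory.
Import numFieldNormedType.Exports.
Local Open Scope ring_scope.

Definition vpairs (n : nat) : {set {set 'I_n}} := [set e : {set 'I_n} | #|e| == 2%N].

Record sgraph (n : nat) := SGraph {
  edges : {set {set 'I_n}};
  _ : edges \subset vpairs n }.

HB.instance Definition _ n := [isSub for @edges n].
HB.instance Definition _ n := [Finite of sgraph n by <:].

(* The diagonal is 0: [set i; i] is a singleton, hence never an edge. *)
Definition adjmx (R : nzRingType) (n : nat) (G : sgraph n) : 'M[R]_n :=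
  \matrix_(i, j) ([set i; j] \in edges G)%:R.

Definition eigenvalues (R : rcfType) (n : nat) (A : 'M[R]_n) : seq R[i] :=
  sval (closed_field_poly_normal (char_poly (map_mx (real_complex R) A))).

Lemma eigenvaluesP (R : rcfType) (n : nat) (A : 'M[R]_n) :
  char_poly (map_mx (real_complex R) A) =
  \prod_(z <- eigenvalues A) ('X - z%:P).
Proof.
rewrite /eigenvalues; case: closed_field_poly_normal => r /= {1}->.
by rewrite (monicP (char_poly_monic _)) scale1r.
Qed.

Definition energy (R : rcfType) (n : nat) (G : sgraph n) : R :=
  \sum_(z <- eigenvalues (adjmx R G)) Normc.normc z.

(* The distribution of G_n(p), the product of the Bernoulli(p) laws over the
   pairs of vertices. *)
Definition Gnp_weight (R : nzRingType) (n : nat) (p : R) (G : sgraph n) : R :=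
  \prod_(e in vpairs n) (if e \in edges G then p else 1 - p).

Definition Gnp_Pr (R : nzRingType) (n : nat) (p : R) (Q : pred (sgraph n)) : R :=
  \sum_(G : sgraph n | Q G) Gnp_weight p G.

(* The edges are independent, each present with probability p; S = set0 gives
   total mass 1. *)
Lemma Gnp_Pr_subset (R : comNzRingType) (n : nat) (p : R) (S : {set {set 'I_n}}) :
  S \subset vpairs n ->
  Gnp_Pr p [pred G : sgraph n | S \subset edges G] = p ^+ #|S|.
Proof.
move=> SV.
pose a e : R := if e \in vpairs n then p else 0.
pose b e : R := if e \in vpairs n then (if e \in S then 0 else 1 - p) else 1.
have ab : \prod_e (a e + b e) = p ^+ #|S|.
  rewrite -prodr_const [RHS]big_mkcond; apply: eq_bigr => e _.
  rewrite /a /b; case: ifPn => eV; last first.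
    by rewrite (contraNF ((fintype.subsetP SV) e) eV) add0r.
  by case: ifP => _; rewrite ?addr0// addrC subrK.
rewrite -ab bigA_distr /= (bigID (fun J : {set _} => (J \subset vpairs n) && (S \subset J))) /=.
rewrite [X in _ + X]big1 ?addr0; last first.
  move=> J; rewrite negb_and => /orP[] /fintype.subsetPn[e eJ eV]; apply/eqP.
    by rewrite (bigD1 e)//= eJ /a (negPf eV) mul0r.
  by rewrite (bigD1 e)//= (negPf eV) /b eJ (fintype.subsetP SV _ eJ) mul0r.
rewrite /Gnp_Pr (reindex_omap (@edges n) insub) /=; last first.
  by move=> J /andP[JV _]; case: insubP => [G _ /= ->|] //; rewrite JV.
apply: eq_big => [G|G SG].
  by rewrite (valP G) /= (valK G) eqxx andbT.
rewrite /Gnp_weight [LHS]big_mkcond; apply: eq_bigr => e _; rewrite /a /b.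
case: ifPn => eV; last by rewrite (contraNF ((fintype.subsetP (valP G)) e) eV).
case: ifPn => // eG; case: ifPn => // eS.
by rewrite (fintype.subsetP SG _ eS) in eG.
Qed.

Local Open Scope classical_set_scope.

Definition almost_every (R : realType) (p : nat -> R)
    (Q : forall n : nat, pred (sgraph n)) : Prop :=
  Gnp_Pr (p n) (Q n) @[n --> \oo] --> (1 : R).

Definition almost_every_o1 (R : realType) (p : nat -> R)
    (err : forall n : nat, sgraph n -> R) : Prop :=
  forall eps : R, 0 < eps ->
    almost_every p (fun n (G : sgraph n) => `|err n G| <= eps).

(* Main.v *)
Require Import Defs.
From mathcomp Require Import all_boot all_order all_algebra.
From mathcomp Require Import complex.
From mathcomp Require Import all_classical all_reals all_analysis.
From mathcomp Require Import ring lra.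
Import Order.TTheory GRing.Theory Num.Theory.
Import numFieldNormedType.Exports.
Import Normc.
Set Implicit Arguments.
Unset Strict Implicit.
Unset Printing Implicit Defensive.
Local Open Scope classical_set_scope.
Local Open Scope ring_scope.

(** Since the integral of x^2 / (x^2 + t^2) over t > 0 is |x| pi / 2, the energy
    is determined by the resolvent (A - i theta)^-1 at purely imaginary points
    theta = t sqrt n.  Let S be its trace.  Expanding the trace of A (A - i theta)^-1
    and integrating by parts over each independent edge (exactly: for a Bernoulli
    variable, (1_e - p) acts as p (1 - p) times the difference operator in the
    edge e), one finds that Q = n + i theta S + p (1 - p) S^2 satisfies
    E |Q|^2 = O(n^(3/2)) uniformly in p.  Testing against the conjugate of Q itself
    makes a separate concentration argument unnecessary, and A need not be centred
    because the sum of the entries of the resolvent is at most n / theta.  The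
    root of the quadratic equation with positive imaginary part is stable, so
    Im S is close to the value predicted by the semicircle law.  Both t-integrals
    have nonincreasing integrands with explicit primitives, so finitely many
    values of t suffice, and Markov's inequality concludes. *)

Local Notation Re := complex.Re.
Local Notation Im := complex.Im.

(** * Resolvents of real symmetric matrices *)

Section ComplexModulus.
Variable R : rcfType.
Implicit Types z w : R[i].

Lemma normc_norm z : (normc z)%:C%C = `|z|.
Proof. by case: z => a b; rewrite normc_def. Qed.

Lemma normc_ge0 z : 0 <= normc z.
Proof. by rewrite -ler0c normc_norm. Qed.

Lemma normcD_le z w : normc (z + w) <= normc z + normc w.
Proof. by rewrite -lecR rmorphD /= !normc_norm ler_normD. Qed.

Lemma normc_opp z : normc (- z) = normc z.
Proof. by apply: complexI; rewrite /= !normc_norm normrN. Qed.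

Lemma normcB_le z w : normc (z - w) <= normc z + normc w.
Proof. by rewrite (le_trans (normcD_le _ _))// normc_opp. Qed.

Lemma normc_conj z : normc (conjc z) = normc z.
Proof. by apply: complexI; rewrite /= !normc_norm normcJ. Qed.

Lemma normc_real (x : R) : normc x%:C%C = `|x|.
Proof. by rewrite /normc /= expr0n addr0 sqrtr_sqr. Qed.

Lemma normc_sum_le (I : Type) (r : seq I) (P : pred I) (F : I -> R[i]) :
  normc (\sum_(i <- r | P i) F i) <= \sum_(i <- r | P i) normc (F i).
Proof.
rewrite -lecR rmorph_sum /= normc_norm (le_trans (ler_norm_sum _ _ _))//.

Qed.

Lemma sqr_normc_ReIm z : normc z ^+ 2 = Re z ^+ 2 + Im z ^+ 2.
Proof. by apply: complexI; rewrite rmorphXn /= normc_norm -add_Re2_Im2. Qed.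

Lemma mulc_conj z : z * conjc z = (normc z ^+ 2)%:C%C.
Proof. by rewrite rmorphXn /= normc_norm sqr_normc. Qed.

Lemma Im_le_normc z : `|Im z| <= normc z.
Proof.
rewrite -(@ler_pXn2r _ 2)// ?nnegrE ?normc_ge0// sqr_normc_ReIm real_normK ?num_real//.
by rewrite lerDr sqr_ge0.
Qed.

Lemma sqr_normc_le z (b : R) : 0 <= b -> normc z ^+ 2 <= b ^+ 2 -> normc z <= b.
Proof. by move=> b0; rewrite ler_pXn2r// nnegrE ?normc_ge0. Qed.

End ComplexModulus.

Section Resolvent.
Variables (R : rcfType) (n : nat).
Implicit Types A : 'M[R]_n.
Local Notation toC := (real_complex R).

Definition shiftmx A (theta : R) : 'M[R[i]]_n := map_mx toC A - (Complex 0 theta)%:M.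

Definition resolvent A theta := invmx (shiftmx A theta).

(* With v = x + i y, the cross terms 2 theta (<Ax,y> - <Ay,x>) cancel by symmetry of A. *)
Lemma shiftmx_expands A (theta : R) (v : 'rV[R[i]]_n) : A^T = A ->
  theta ^+ 2 * \sum_j normc (v 0 j) ^+ 2
    <= \sum_j normc ((v *m shiftmx A theta) 0 j) ^+ 2.
Proof.
move=> symA.
pose x j := Re (v 0 j); pose y j := Im (v 0 j).
pose a (f : 'I_n -> R) j := \sum_k f k * A k j.
have wE j : (v *m shiftmx A theta) 0 j
    = Complex (a x j + theta * y j) (a y j - theta * x j).
  rewrite /shiftmx mulmxBr mul_mx_scalar !mxE.
  have -> : \sum_k v 0 k * map_mx toC A k j = Complex (a x j) (a y j).
    apply/eqP; rewrite eq_complex /= !raddf_sum /=; apply/andP; split; apply/eqP;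
      by apply: eq_bigr => k _; rewrite mxE /x /y; case: (v 0 k) => c d /=; ring.
  by rewrite /x /y; case: (v 0 j) => c d; apply/eqP;
    rewrite eq_complex /=; apply/andP; split; apply/eqP; ring.
have cross : \sum_j (a x j * y j - a y j * x j) = 0.
  rewrite sumrB; apply/eqP; rewrite subr_eq0; apply/eqP.
  under eq_bigr do rewrite mulr_suml.
  rewrite exchange_big /=; apply: eq_bigr => k _.
  rewrite mulr_suml; apply: eq_bigr => j _.
  have -> : A j k = A k j by rewrite -[in LHS]symA mxE.
  by ring.
have -> : \sum_j normc ((v *m shiftmx A theta) 0 j) ^+ 2 =
    \sum_j (a x j ^+ 2 + a y j ^+ 2) + theta ^+ 2 * \sum_j normc (v 0 j) ^+ 2
    + 2 * theta * \sum_j (a x j * y j - a y j * x j).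
  rewrite !mulr_sumr -!big_split /=; apply: eq_bigr => j _.
  by rewrite wE !sqr_normc_ReIm /= -/(x j) -/(y j); ring.
by rewrite cross mulr0 addr0 lerDr sumr_ge0// => j _; rewrite addr_ge0// sqr_ge0.
Qed.

Variables (A : 'M[R]_n) (theta : R).
Hypotheses (symA : A^T = A) (theta0 : 0 < theta).
Local Notation G := (resolvent A theta).
Local Notation b := (theta^-1).

Lemma shiftmx_unit : shiftmx A theta \in unitmx.
Proof.
rewrite unitmxE unitfE; apply/negP => /det0P[v /negP v0 vS]; apply: v0.
have := shiftmx_expands theta v symA; rewrite vS.
rewrite [X in _ <= X]big1 => [|j _]; last by rewrite mxE normc0 expr0n.
rewrite pmulr_rle0 ?exprn_gt0// => le0.
have /eqP : \sum_j normc (v 0 j) ^+ 2 = 0.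
  by apply/eqP; rewrite eq_le le0 sumr_ge0// => j _; rewrite sqr_ge0.
rewrite psumr_eq0 => [/allP vz|j _]; last by rewrite sqr_ge0.
apply/eqP/rowP => j; rewrite mxE.
have := vz j (mem_index_enum j); rewrite /= sqrf_eq0 => /eqP.
exact: eq0_normc.
Qed.

Lemma resolvent_contracts (v : 'rV[R[i]]_n) :
  \sum_j normc ((v *m G) 0 j) ^+ 2 <= b ^+ 2 * \sum_j normc (v 0 j) ^+ 2.
Proof.
have := shiftmx_expands theta (v *m G) symA.
rewrite -mulmxA mulVmx ?shiftmx_unit// mulmx1 => le.
by rewrite exprVn mulrC ler_pdivlMr ?exprn_gt0// mulrC.
Qed.

Lemma resolvent_sym i j : G i j = G j i.
Proof.
rewrite -[in RHS](trmxK G) mxE /resolvent trmx_inv; congr (invmx _ _ _).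
by rewrite /shiftmx linearB /= tr_scalar_mx map_trmx symA.
Qed.

(** A row is the image of a unit vector, so contraction bounds its l2 norm. As the bound is free of
    n, sums along a row cost no factor n. *)
Lemma resolvent_row i : \sum_j normc (G i j) ^+ 2 <= b ^+ 2.
Proof.
have := resolvent_contracts (delta_mx 0 i); rewrite -rowE.
have -> : \sum_j normc ((delta_mx 0 i : 'rV[R[i]]_n) 0 j) ^+ 2 = 1.
  rewrite (bigD1 i)//= big1 => [|j /negbTE ji]; last by rewrite mxE ji andbF normc0 expr0n.
  by rewrite mxE !eqxx normc1 expr1n addr0.
rewrite mulr1; apply: le_trans.
by apply: ler_sum => j _; rewrite mxE.
Qed.

Lemma resolvent_entry i j : normc (G i j) <= b.
Proof.
apply: sqr_normc_le; first by rewrite invr_ge0 ltW.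
apply: le_trans (resolvent_row i); rewrite (bigD1 j)//= lerDl.
by rewrite sumr_ge0// => k _; rewrite sqr_ge0.
Qed.

Lemma resolvent_trace_le : normc (\tr G) <= n%:R * b.
Proof.
rewrite (le_trans (normc_sum_le _ _ _))//.
rewrite (le_trans (ler_sum _ (fun i _ => resolvent_entry i i)))//.
by rewrite sumr_const card_ord -[_ *+ n]mulr_natl.
Qed.

(* AM-GM in the form 2|x| <= theta |x|^2 + 1/theta replaces Cauchy-Schwarz. *)
Lemma resolvent_sum_le : normc (\sum_i \sum_j G i j) <= n%:R * b.
Proof.
pose v : 'rV[R[i]]_n := const_mx 1.
have -> : \sum_i \sum_j G i j = \sum_j (v *m G) 0 j.
  rewrite exchange_big; apply: eq_bigr => j _; rewrite mxE.
  by apply: eq_bigr => i _; rewrite mxE mul1r.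
have := resolvent_contracts v.
rewrite [X in _ * X](eq_bigr (fun=> 1)) => [|j _]; last by rewrite mxE normc1 expr1n.
rewrite sumr_const card_ord => le.
rewrite (le_trans (normc_sum_le _ _ _))//.
have amgm j : normc ((v *m G) 0 j) <= theta / 2 * normc ((v *m G) 0 j) ^+ 2 + b / 2.
  set c := normc _; have : 0 <= b * (theta * c - 1) ^+ 2.
    by rewrite mulr_ge0 ?sqr_ge0// invr_ge0 ltW.
  have -> : b * (theta * c - 1) ^+ 2 = theta * c ^+ 2 - 2 * c + b.
    by field; rewrite gt_eqF.
  by lra.
rewrite (le_trans (ler_sum _ (fun j _ => amgm j)))// big_split /= -mulr_sumr.
rewrite sumr_const card_ord -mulr_natr.
have : theta / 2 * \sum_j normc ((v *m G) 0 j) ^+ 2 <= theta / 2 * (b ^+ 2 *+ n * 1).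
  by rewrite ler_pM2l ?divr_gt0// mulr1 -mulr_natr.
have -> : theta / 2 * (b ^+ 2 *+ n * 1) = n%:R * b / 2.
  by rewrite -mulr_natr; field; rewrite gt_eqF.
by lra.
Qed.

Lemma mulmx_resolvent : map_mx toC A *m G = 1%:M + Complex 0 theta *: G.
Proof.
have /eqP := mulmxV shiftmx_unit.
by rewrite {1}/shiftmx mulmxBl subr_eq mul_scalar_mx => /eqP.
Qed.

(** Taking traces in A G = 1 + i theta G exposes every entry of A as a linear factor, ready for
    integration by parts over that edge. *)
Lemma trace_resolvent_identity :
  n%:R + Complex 0 theta * \tr G = \sum_i \sum_j (A i j)%:C%C * G i j.
Proof.
have := congr1 (@mxtrace _ n) mulmx_resolvent.
rewrite linearD linearZ /= mxtrace1 => <-.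
apply: eq_bigr => i _; rewrite mxE; apply: eq_bigr => j _.
by rewrite mxE [G j i]resolvent_sym.
Qed.

End Resolvent.

(** * Effect of a single edge on the resolvent *)

Section EdgePerturbation.
Variables (R : rcfType) (n : nat) (theta : R) (A A' : 'M[R]_n) (i j : 'I_n).
Hypotheses (theta0 : 0 < theta) (symA : A^T = A) (symA' : A'^T = A').
Hypothesis (AA' : A' = A + delta_mx i j + delta_mx j i).
Local Notation G := (resolvent A theta).
Local Notation G' := (resolvent A' theta).
Local Notation b := (theta^-1).

(** The resolvent identity G' - G = - G' (A' - A) G, with A' - A a sum of two matrix units. *)
Lemma resolvent_perturb k l :
  G' k l - G k l = - (G' k i * G j l + G' k j * G i l).
Proof.
have -> : G' k l - G k l = (G' - G) k l by rewrite !mxE.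
have -> : G' - G = - (G' *m (delta_mx i j + delta_mx j i) *m G).
  have -> : delta_mx i j + delta_mx j i = shiftmx A' theta - shiftmx A theta.
    rewrite /shiftmx AA' !map_mxD /= !map_delta_mx.
    by apply/matrixP => u v; rewrite !mxE; ring.
  rewrite mulmxBr mulVmx ?shiftmx_unit// mulmxBl mul1mx -mulmxA mulmxV ?shiftmx_unit//.
  by rewrite mulmx1 opprB.
rewrite mulmxDr mulmxDl !mxE; congr (- (_ + _)).
  rewrite (bigD1 j)//= big1 => [|m mj]; rewrite ?addr0 !mxE; last first.
    by rewrite big1 ?mul0r// => q _; rewrite !mxE (negPf mj) andbF mulr0.
  rewrite (bigD1 i)//= big1 => [|m mi]; rewrite ?addr0 !mxE ?eqxx ?mulr1//.
  by rewrite (negPf mi) mulr0.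
rewrite (bigD1 i)//= big1 => [|m mj]; rewrite ?addr0 !mxE; last first.
  by rewrite big1 ?mul0r// => q _; rewrite !mxE (negPf mj) andbF mulr0.
rewrite (bigD1 j)//= big1 => [|m mi]; rewrite ?addr0 !mxE ?eqxx ?mulr1//.
by rewrite (negPf mi) mulr0.
Qed.

Lemma resolvent_perturb_le k l : normc (G' k l - G k l) <= 2 * b ^+ 2.
Proof.
have b0 : 0 <= b by rewrite invr_ge0 ltW.
have bb (x y : R[i]) : normc x <= b -> normc y <= b -> normc (x * y) <= b ^+ 2.
  by move=> xb yb; rewrite normcM expr2 ler_pM ?normc_ge0.
rewrite resolvent_perturb normc_opp (le_trans (normcD_le _ _))//.
have := bb _ _ (resolvent_entry symA' theta0 k i) (resolvent_entry symA theta0 j l).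
have := bb _ _ (resolvent_entry symA' theta0 k j) (resolvent_entry symA theta0 i l).
by lra.
Qed.

(** Each of the two sums pairs a row of G' with a row of G, so AM-GM and the row bounds give
    [theta^-2] without a factor n. *)
Lemma trace_perturb_le : normc (\tr G' - \tr G) <= 2 * b ^+ 2.
Proof.
rewrite /mxtrace -sumrB.
under eq_bigr do rewrite resolvent_perturb.
rewrite sumrN normc_opp big_split /=.
have half (k l : 'I_n) : normc (\sum_m G' m k * G l m) <= b ^+ 2.
  rewrite (le_trans (normc_sum_le _ _ _))//.
  have amgm m : normc (G' m k * G l m)
      <= (normc (G' k m) ^+ 2 + normc (G l m) ^+ 2) / 2.
    rewrite normcM [G' m k]resolvent_sym//.
    set x := normc _; set y := normc _; have := sqr_ge0 (x - y); nra.
  rewrite (le_trans (ler_sum _ (fun m _ => amgm m)))// -mulr_suml big_split /=.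
  have := resolvent_row symA' theta0 k; have := resolvent_row symA theta0 l.
  by lra.
rewrite (le_trans (normcD_le _ _))//.
by have := half i j; have := half j i; lra.
Qed.

End EdgePerturbation.

(** * The random graph *)

Section Bernoulli.
Variables (K : comNzRingType) (T : finType) (V : {set T}) (p : K).
Implicit Types (J : {set T}) (e : T).

(** Indexed by sets rather than graphs, so that edges can be added and removed freely; over a
    commutative ring, so that real and complex copies coexist. *)
Definition bernoulli_weight J : K := \prod_(e in V) (if e \in J then p else 1 - p).

Lemma sum_subsets_pair e (g : {set T} -> K) : e \in V ->
  \sum_(J : {set T} | J \subset V) g J =
  \sum_(J : {set T} | (J \subset V) && (e \notin J)) (g (e |: J) + g J).
Proof.
move=> eV; rewrite (bigID (fun J : {set T} => e \in J)) /= big_split /=; congr (_ + _).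
rewrite (reindex_onto (fun J => e |: J) (fun J => J :\ e)) /=; last first.
  by move=> J /andP[_ eJ]; exact: finset.setD1K.
apply: eq_bigl => J; rewrite finset.setU11 andbT finset.subUset finset.sub1set eV /=.
congr (_ && _); apply/eqP/idP => [<-|]; [by rewrite finset.setD11 | exact: finset.setU1K].
Qed.

(** The ratio p / (1 - p) of the two weights in cross-multiplied form, which also covers p = 0 and p
    = 1. *)
Lemma bernoulli_weightU1 e J : e \in V -> e \notin J ->
  (1 - p) * bernoulli_weight (e |: J) = p * bernoulli_weight J.
Proof.
move=> eV eJ; rewrite /bernoulli_weight (bigD1 e)//= [in RHS](bigD1 e)//=.
rewrite finset.setU11 (negbTE eJ) mulrCA; congr (_ * (_ * _)).
by apply: eq_bigr => e' /andP[_ /negbTE e'e]; rewrite finset.in_setU1 e'e.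
Qed.

(* Discrete integration by parts: a centred Bernoulli variable acts as
   p (1 - p) times a difference operator. *)
Lemma bernoulli_ibp e (f : {set T} -> K) : e \in V ->
  \sum_(J : {set T} | J \subset V) bernoulli_weight J * (((e \in J)%:R - p) * f J) =
  p * (1 - p) *
  \sum_(J : {set T} | J \subset V) bernoulli_weight J * (f (e |: J) - f (J :\ e)).
Proof.
move=> eV; rewrite mulr_sumr !(sum_subsets_pair _ eV).
apply: eq_bigr => J /andP[_ eJ]; have := bernoulli_weightU1 eV eJ.
rewrite finset.setU11 (negbTE eJ) finset.setUA finset.setUid finset.setU1K//.
have -> : J :\ e = J.
  by apply/setP => x; rewrite finset.in_setD1; case: eqP => // ->; rewrite (negbTE eJ).
move: (bernoulli_weight (e |: J)) (bernoulli_weight J) (f (e |: J)) (f J) => w1 w0 f1 f0 w10.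
(* Both sides equal p w0 (f1 - f0), because (1 - p) w1 = p w0. *)
rewrite mulr1n mulr0n; transitivity ((1 - p) * w1 * f1 - p * w0 * f0); first by ring.
have -> : p * (1 - p) * (w1 * (f1 - f0)) + p * (1 - p) * (w0 * (f1 - f0)) =
  (p * ((1 - p) * w1) + (1 - p) * (p * w0)) * (f1 - f0) by ring.
by rewrite w10; ring.
Qed.

End Bernoulli.

(** * Adjacency matrices of edge sets *)

Section Adjacency.
Variables (R : rcfType) (n : nat).
Implicit Types (J : {set {set 'I_n}}) (i j k l : 'I_n).

Definition set_adjmx J : 'M[R]_n := \matrix_(i, j) (([set i; j])%SET \in J)%:R.

Lemma set_adjmx_sym J : (set_adjmx J)^T = set_adjmx J.
Proof. by apply/matrixP => i j; rewrite !mxE finset.setUC. Qed.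

Lemma set2_eq i j k l : i != j ->
  ([set k; l]%SET == [set i; j]%SET) = (k == i) && (l == j) || (k == j) && (l == i).
Proof.
move=> /negbTE ij; rewrite finset.eqEsubset !finset.subUset !finset.sub1set !in_set2.
rewrite ![i == _]eq_sym ![j == _]eq_sym.
case: (eqVneq k i) => [->|ki]; case: (eqVneq l i) => [->|li];
case: (eqVneq k j) => [kj|kj]; case: (eqVneq l j) => [lj|lj]; rewrite ?ij ?andbF ?andbT ?orbT //=.
all: try by subst; rewrite ?eqxx in ij.
Qed.

Lemma set_adjmx_edge J i j : i != j ->
  set_adjmx ([set i; j]%SET |: J) =
  set_adjmx (J :\ [set i; j]%SET) + delta_mx i j + delta_mx j i.
Proof.
move=> ij; apply/matrixP => k l; rewrite !mxE finset.in_setU1 finset.in_setD1 set2_eq//.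
(* As i and j differ, (k, l) cannot be both (i, j) and (j, i), so the two indicators never add up to
   2. *)
have : ~~ ((k == i) && (l == j) && ((k == j) && (l == i))).
  by apply: contra ij => /andP[/andP[/eqP<- _] /andP[/eqP<- _]].
by case: (_ && (l == j)); case: (_ && (l == i)); rewrite //= ?add0r ?addr0.
Qed.

Lemma edge_in_vpairs i j : ([set i; j]%SET \in vpairs n) = (i != j).
Proof. by rewrite inE cards2; case: (i != j). Qed.

Lemma set_adjmx_diag J i : J \subset vpairs n -> set_adjmx J i i = 0.
Proof.
move=> JV; rewrite mxE; case: (boolP (_ \in J)) => // /(fintype.subsetP JV).
by rewrite edge_in_vpairs eqxx.
Qed.

End Adjacency.

(** * The quadratic expression in the trace of the resolvent *)

Section SemicirclePolynomial.
Variables (R : rcfType) (n : nat) (theta s2 : R).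
Hypotheses (theta0 : 0 < theta) (s20 : 0 <= s2) (s21 : s2 <= 1 / 4).
Local Notation b := (theta^-1).

(* n times the Stieltjes transform at i theta of the semicircle law of variance
   n s2 is a root. *)
Definition semicircle_poly (S : R[i]) : R[i] :=
  n%:R + Complex 0 theta * S + s2%:C%C * S ^+ 2.

(** For |S| <= n / theta and s2 <= 1/4, [sp_bound] bounds the modulus of the quadratic, and
    [sp_step] its change when S moves by at most 2 / theta^2, the effect of one edge. *)
Definition sp_bound : R := 2 * n%:R + n%:R ^+ 2 * b ^+ 2 / 4.
Definition sp_step : R := 2 * b + n%:R * b ^+ 3.

Let b0 : 0 <= b. Proof. by rewrite invr_ge0 ltW. Qed.

Let thetab : theta * b = 1. Proof. by rewrite divff// gt_eqF. Qed.

Let normc_itheta : normc (Complex 0 theta) = theta.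
Proof. by rewrite /normc expr0n add0r sqrtr_sqr gtr0_norm. Qed.

Lemma normc_natr : normc (n%:R : R[i]) = n%:R.
Proof.
have -> : (n%:R : R[i]) = (n%:R : R)%:C%C by rewrite rmorph_nat.
by rewrite normc_real normr_nat.
Qed.

Lemma sp_bound_ge0 : 0 <= sp_bound.
Proof. by rewrite addr_ge0 ?mulr_ge0 ?exprn_ge0. Qed.

Lemma sp_step_ge0 : 0 <= sp_step.
Proof. by rewrite addr_ge0 ?mulr_ge0 ?exprn_ge0. Qed.

Lemma semicircle_poly_le S : normc S <= n%:R * b -> normc (semicircle_poly S) <= sp_bound.
Proof.
move=> Sb; have S2 : normc S ^+ 2 <= (n%:R * b) ^+ 2.
  by rewrite ler_pXn2r ?nnegrE ?normc_ge0// mulr_ge0.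
have tS : theta * normc S <= n%:R.
  by rewrite (le_trans (ler_wpM2l (ltW theta0) Sb))// mulrCA thetab mulr1.
rewrite (le_trans (normcD_le _ _))// normcM normc_real ger0_norm// expr2 normcM -expr2.
have : s2 * normc S ^+ 2 <= 1 / 4 * (n%:R * b) ^+ 2 by rewrite ler_pM ?sqr_ge0.
have := normcD_le n%:R (Complex 0 theta * S).
rewrite normcM normc_itheta normc_natr exprMn /sp_bound; lra.
Qed.

Lemma semicircle_poly_lip S S' : normc S <= n%:R * b -> normc S' <= n%:R * b ->
  normc (S' - S) <= 2 * b ^+ 2 ->
  normc (semicircle_poly S' - semicircle_poly S) <= sp_step.
Proof.
move=> Sb S'b SS'.
have -> : semicircle_poly S' - semicircle_poly S =
  (Complex 0 theta + s2%:C%C * (S' + S)) * (S' - S) by rewrite /semicircle_poly; ring.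
rewrite normcM.
have le1 : normc (Complex 0 theta + s2%:C%C * (S' + S)) <= theta + n%:R * b / 2.
  rewrite (le_trans (normcD_le _ _))// normc_itheta normcM normc_real ger0_norm// lerD2l.
  have : s2 * normc (S' + S) <= 1 / 4 * (2 * (n%:R * b)).
    rewrite ler_pM ?normc_ge0// (le_trans (normcD_le _ _))//; lra.
  by lra.
rewrite (le_trans (ler_pM (normc_ge0 _) (normc_ge0 _) le1 SS'))//.
have -> : (theta + n%:R * b / 2) * (2 * b ^+ 2) = sp_step; last by [].
by rewrite /sp_step; field; rewrite gt_eqF.
Qed.

Section Edge.
Variables (A A0 A1 : 'M[R]_n) (i j : 'I_n).
Hypotheses (symA0 : A0^T = A0) (symA1 : A1^T = A1).
Hypothesis (A10 : A1 = A0 + delta_mx i j + delta_mx j i) (A01 : A = A0 \/ A = A1).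
Local Notation G := (resolvent A theta).
Local Notation G0 := (resolvent A0 theta).
Local Notation G1 := (resolvent A1 theta).
Local Notation qc M := (conjc (semicircle_poly (\tr (resolvent M theta)))).

(** A discrete product rule. The difference of the entry is - (G_ii G_jj + G_ij^2) to leading order,
    by the resolvent identity. That identity mixes G0 and G1; writing everything in the resolvent of
    the current A costs O(theta^-3), and the conjugate factor changes by at most [sp_step]. *)
Lemma edge_difference_le :
  normc (G1 i j * qc A1 - G0 i j * qc A0 + (G i i * G j j + G i j ^+ 2) * qc A)
    <= 4 * b ^+ 3 * sp_bound + b * sp_step.
Proof.
have symA : A^T = A by case: A01 => ->.
have qA : normc (qc A) <= sp_bound.
  by rewrite normc_conj semicircle_poly_le// resolvent_trace_le.
have step : normc (qc A1 - qc A0) <= sp_step.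
  rewrite -rmorphB normc_conj semicircle_poly_lip ?resolvent_trace_le//.
  exact: trace_perturb_le A10.
have pert := resolvent_perturb theta0 symA0 symA1 A10.
have pert_le := resolvent_perturb_le theta0 symA0 symA1 A10.
have prod_le (x y : R[i]) : normc x <= b -> normc y <= 2 * b ^+ 2 ->
    normc (x * y) <= 2 * b ^+ 3.
  move=> xb yb; rewrite normcM (le_trans (ler_pM _ _ xb yb)) ?normc_ge0//.
  by rewrite le_eqVlt; apply/orP; left; apply/eqP; ring.
(* X collects the two errors of replacing an entry of one resolvent by that of the other; k is the
   (i, j) entry of the resolvent at the endpoint other than A. *)
have [X [X_le [k [k_le ->]]]] : exists X : R[i], normc X <= 4 * b ^+ 3 /\
    exists k, normc k <= b /\
    G1 i j * qc A1 - G0 i j * qc A0 + (G i i * G j j + G i j ^+ 2) * qc A =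
    X * qc A + k * (qc A1 - qc A0).
  case: A01 => AE; rewrite AE.
    exists (- ((G1 i i - G0 i i) * G0 j j + (G1 i j - G0 i j) * G0 i j)); split.
      rewrite normc_opp (le_trans (normcD_le _ _))//.
      have := prod_le _ _ (resolvent_entry symA0 theta0 j j) (pert_le i i).
      have := prod_le _ _ (resolvent_entry symA0 theta0 i j) (pert_le i j).
      rewrite ![normc (_ * (_ - _))]normcM ![normc ((_ - _) * _)]normcM.
      by rewrite ![normc (G0 _ _) * _]mulrC; lra.
    exists (G1 i j); split; first exact: resolvent_entry.
    apply/eqP; rewrite -subr_eq0; apply/eqP.
    transitivity ((G1 i j - G0 i j + (G1 i i * G0 j j + G1 i j * G0 i j)) * qc A0).
      by ring.
    by rewrite pert addNr mul0r.
  exists (G1 i i * (G1 j j - G0 j j) + G1 i j * (G1 i j - G0 i j)); split.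
    rewrite (le_trans (normcD_le _ _))//.
    have := prod_le _ _ (resolvent_entry symA1 theta0 i i) (pert_le j j).
    by have := prod_le _ _ (resolvent_entry symA1 theta0 i j) (pert_le i j); lra.
  exists (G0 i j); split; first exact: resolvent_entry.
  apply/eqP; rewrite -subr_eq0; apply/eqP.
  transitivity ((G1 i j - G0 i j + (G1 i i * G0 j j + G1 i j * G0 i j)) * qc A1).
    by ring.
  by rewrite pert addNr mul0r.
rewrite (le_trans (normcD_le _ _))// !normcM lerD// ler_pM ?normc_ge0//.
Qed.

End Edge.

(** The squared trace contains the diagonal products G_ii^2 that the left sum omits. They and the
    terms G_ij^2 together make up one entry of modulus |G_ij|^2 for each pair (i, j), and the row
    bounds apply. *)
Lemma offdiag_sum_le (G : 'M[R[i]]_n) :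
  (forall i, \sum_j normc (G i j) ^+ 2 <= b ^+ 2) ->
  normc (\sum_i \sum_(j | j != i) (G i i * G j j + G i j ^+ 2) - (\tr G) ^+ 2)
    <= n%:R * b ^+ 2.
Proof.
move=> rowG; pose c i j := if j == i then - G i i ^+ 2 else G i j ^+ 2.
have -> : \sum_i \sum_(j | j != i) (G i i * G j j + G i j ^+ 2) - (\tr G) ^+ 2 =
   \sum_i \sum_j c i j.
  rewrite expr2 [in X in _ - X]/mxtrace mulr_suml -sumrB; apply: eq_bigr => i _.
  rewrite mulr_sumr (bigD1 i (P := xpredT))//= [in RHS](bigD1 i)//= {1}/c eqxx.
  rewrite opprD addrCA -sumrB -expr2; congr (_ + _).
  by apply: eq_bigr => j /negbTE ji; rewrite /c ji addrAC subrr add0r.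
have cE i j : normc (c i j) = normc (G i j) ^+ 2.
  by rewrite /c; case: eqP => [->|_]; rewrite ?normc_opp expr2 normcM.
rewrite (le_trans (normc_sum_le _ _ _))//.
have -> : n%:R * b ^+ 2 = \sum_(i < n) b ^+ 2.
  by rewrite sumr_const card_ord -[RHS]mulr_natl.
apply: ler_sum => i _; rewrite (le_trans (normc_sum_le _ _ _))//.
by rewrite (le_trans _ (rowG i))//; apply: ler_sum => j _; rewrite cE.
Qed.

End SemicirclePolynomial.

Lemma offdiag_close_le (R : rcfType) (n : nat) (d g : 'I_n -> 'I_n -> R[i]) (c : R[i]) (K : R) :
  0 <= K -> (forall i j, j != i -> normc (d i j + g i j * c) <= K) ->
  normc (\sum_i \sum_(j | j != i) d i j + (\sum_i \sum_(j | j != i) g i j) * c)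
    <= n%:R ^+ 2 * K.
Proof.
move=> K0 dgK; rewrite mulr_suml -big_split /= (le_trans (normc_sum_le _ _ _))//.
have -> : n%:R ^+ 2 * K = \sum_(i < n) \sum_(j < n) K.
  by rewrite !sumr_const !card_ord -mulrnA -[RHS]mulr_natl natrM expr2.
apply: ler_sum => i _; rewrite mulr_suml -big_split /=.
rewrite (le_trans (normc_sum_le _ _ _))// [leLHS]big_mkcond /=.
by apply: ler_sum => j _; case: ifPn => // ji; exact: dgK.
Qed.

(** * Second moment of the quadratic expression *)

Section Expectation.
Variables (R : rcfType) (n : nat).
Implicit Types (J : {set {set 'I_n}}) (p : R).
Local Notation V := (vpairs n).

Lemma sum_sgraph (F : {set {set 'I_n}} -> R) p :
  \sum_(G : sgraph n) Gnp_weight p G * F (edges G) =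
  \sum_(J : {set {set 'I_n}} | J \subset V) bernoulli_weight V p J * F J.
Proof.
rewrite [RHS](reindex_omap (@edges n) insub) /=; last first.
  by move=> J JV; case: insubP => [G _ /= ->|] //; rewrite JV.
by apply: eq_bigl => G; rewrite (valP G) /= (valK G) eqxx.
Qed.

Lemma Gnp_weight_ge0 p (G : sgraph n) : 0 <= p <= 1 -> 0 <= Gnp_weight p G.
Proof.
by move=> /andP[p0 p1]; apply: prodr_ge0 => e _; case: ifP; rewrite // subr_ge0.
Qed.

Lemma bernoulli_weight_ge0 p J : 0 <= p <= 1 -> 0 <= bernoulli_weight V p J.
Proof.
by move=> /andP[p0 p1]; apply: prodr_ge0 => e _; case: ifP; rewrite // subr_ge0.
Qed.

Lemma Gnp_weight_sum p : \sum_(G : sgraph n) Gnp_weight p G = 1.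
Proof.
have := Gnp_Pr_subset p (finset.sub0set V); rewrite cards0 expr0 => <-.
by apply: eq_bigl => G /=; rewrite finset.sub0set.
Qed.

Lemma bernoulli_weight_sum p :
  \sum_(J : {set {set 'I_n}} | J \subset V) bernoulli_weight V p J = 1.
Proof.
rewrite -(Gnp_weight_sum p); have := sum_sgraph (fun=> 1) p.
by under eq_bigr do rewrite mulr1; under [in RHS]eq_bigr do rewrite mulr1.
Qed.

Variables (theta p : R).
Hypotheses (theta0 : 0 < theta) (p01 : 0 <= p <= 1).
Local Notation b := (theta^-1).
Local Notation s2 := (p * (1 - p)).
Local Notation B := (sp_bound n theta).
Local Notation D := (sp_step n theta).

Let G J := resolvent (set_adjmx R J) theta.
Let q J := semicircle_poly n theta s2 (\tr (G J)).
(** The weights as complex numbers, since the functions integrated by parts are complex-valued. *)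
Let wC J : R[i] := bernoulli_weight V p%:C%C J.

Let s20 : 0 <= s2. Proof. by move: p01 => /andP[p0 p1]; rewrite mulr_ge0// subr_ge0. Qed.

Let s21 : s2 <= 1 / 4. Proof. have := sqr_ge0 (p - 1 / 2); lra. Qed.

Let b0 : 0 <= b. Proof. by rewrite invr_ge0 ltW. Qed.

Let wCE J : wC J = (bernoulli_weight V p J)%:C%C.
Proof.
rewrite /wC /bernoulli_weight rmorph_prod /=; apply: eq_bigr => e _.
by case: ifP => // _; rewrite rmorphB rmorph1.
Qed.

Let q_le J : normc (q J) <= B.
Proof. by rewrite semicircle_poly_le// resolvent_trace_le// set_adjmx_sym. Qed.

Let offdiag J := \sum_i \sum_(j | j != i) G J i j.

(** The sum of all entries minus the trace, each at most n / theta. Multiplied by p this is the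
    contribution of the mean of A, hence an error term. *)
Let offdiag_le J : normc (offdiag J) <= 2 * (n%:R * b).
Proof.
have -> : offdiag J = \sum_i \sum_j G J i j - \tr (G J).
  rewrite -sumrB; apply: eq_bigr => i _.
  by rewrite [in RHS](bigD1 i)//= addrAC subrr add0r.
rewrite (le_trans (normcB_le _ _))//.
have := resolvent_sum_le (set_adjmx_sym R J) theta0.
by have := resolvent_trace_le (set_adjmx_sym R J) theta0; rewrite -/(G J); lra.
Qed.

(** The trace identity, with each off-diagonal entry of A split into a centred Bernoulli variable
    and its mean p. *)
Let q_expand J : J \subset V -> q J =
  \sum_i \sum_(j | j != i) ((([set i; j]%SET \in J)%:R - p%:C%C) * G J i j)
  + p%:C%C * offdiag J + s2%:C%C * (\tr (G J)) ^+ 2.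
Proof.
move=> JV; rewrite /q /semicircle_poly trace_resolvent_identity ?set_adjmx_sym//.
congr (_ + _); rewrite mulr_sumr -big_split /=; apply: eq_bigr => i _.
rewrite (bigD1 i)//= set_adjmx_diag// mul0r add0r mulr_sumr -big_split /=.
apply: eq_bigr => j _; rewrite mxE -/(G J) mulrBl subrK.
by rewrite rmorph_nat.
Qed.

Let up i j J := ([set i; j] |: J)%SET.
Let dn i j J := (J :\ [set i; j])%SET.

Let difference_sum J :=
  \sum_i \sum_(j | j != i)
     (G (up i j J) i j * conjc (q (up i j J)) - G (dn i j J) i j * conjc (q (dn i j J))).

(** Integration by parts produces s2 times [difference_sum]. Up to this error it is minus s2 (tr
    G)^2 times the conjugate of q, so it cancels the quadratic term of [q_expand]. *)
Let difference_sum_le J :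
  normc (difference_sum J + (\tr (G J)) ^+ 2 * conjc (q J))
  <= n%:R ^+ 2 * (4 * b ^+ 3 * B + b * D) + n%:R * b ^+ 2 * B.
Proof.
set K := 4 * b ^+ 3 * B + b * D.
pose T := \sum_i \sum_(j | j != i) (G J i i * G J j j + G J i j ^+ 2).
have -> : difference_sum J + (\tr (G J)) ^+ 2 * conjc (q J) =
  (difference_sum J + T * conjc (q J)) - (T - (\tr (G J)) ^+ 2) * conjc (q J) by ring.
rewrite (le_trans (normcB_le _ _))// lerD//.
  apply: offdiag_close_le => [|i j ji].
    by rewrite /K !addr_ge0 ?mulr_ge0 ?exprn_ge0 ?sp_bound_ge0 ?sp_step_ge0.
  have ij : i != j by rewrite eq_sym.
  apply: edge_difference_le; rewrite ?set_adjmx_sym//; first exact: set_adjmx_edge.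
  (* J itself is [up i j J] or [dn i j J], according to whether it contains the edge. *)
  rewrite /up /dn; case: (boolP ([set i; j]%SET \in J)) => eJ; [right|left]; congr set_adjmx.
    by apply/setP => e; rewrite finset.in_setU1; case: eqP => // ->; rewrite eJ.
  by apply/setP => e; rewrite finset.in_setD1; case: eqP => // ->; rewrite (negbTE eJ).
rewrite normcM normc_conj ler_pM ?normc_ge0//.
by apply: offdiag_sum_le => // i; rewrite resolvent_row ?set_adjmx_sym.
Qed.

(** For theta of order sqrt n the bound is O(n^(3/2)), whereas [sp_bound] alone would give n^2. The
    gain is the cancellation in [difference_sum_le]. *)
Lemma expectation_semicircle_poly_le :
  \sum_(J : {set {set 'I_n}} | J \subset V) bernoulli_weight V p J * normc (q J) ^+ 2
  <= n%:R ^+ 2 * (4 * b ^+ 3 * B + b * D) + n%:R * b ^+ 2 * B + 2 * (n%:R * b) * B.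
Proof.
set E := \sum_(J | _) _.
have EE : E%:C%C = \sum_(J : {set {set 'I_n}} | J \subset V)
    wC J * (s2%:C%C * (difference_sum J + (\tr (G J)) ^+ 2 * conjc (q J))
            + p%:C%C * offdiag J * conjc (q J)).
  rewrite /E rmorph_sum /=.
  (* Only the first factor of |q|^2 = q conj(q) is expanded; the conjugate stays in the function
     that is integrated by parts. *)
  transitivity (\sum_(J : {set {set 'I_n}} | J \subset V)
    (\sum_i \sum_(j | j != i)
       wC J * ((([set i; j]%SET \in J)%:R - p%:C%C) * (G J i j * conjc (q J)))
     + wC J * ((p%:C%C * offdiag J + s2%:C%C * (\tr (G J)) ^+ 2) * conjc (q J)))).
    apply: eq_bigr => J JV; rewrite rmorphM /= -wCE -mulc_conj {1}q_expand//.
    rewrite -addrA mulrDl mulrDr; congr (_ + _).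
    rewrite mulr_suml mulr_sumr; apply: eq_bigr => i _.
    by rewrite mulr_suml mulr_sumr; apply: eq_bigr => j _; rewrite !mulrA.
  (* The sum over J moves innermost, so that each pair (i, j) is integrated by parts on its own. *)
  rewrite big_split /= exchange_big /=.
  under eq_bigr do rewrite exchange_big /=.
  have ibp i j : j != i -> \sum_(J : {set {set 'I_n}} | J \subset V)
      wC J * ((([set i; j]%SET \in J)%:R - p%:C%C) * (G J i j * conjc (q J))) =
    \sum_(J : {set {set 'I_n}} | J \subset V) wC J * (s2%:C%C *
      (G (up i j J) i j * conjc (q (up i j J)) - G (dn i j J) i j * conjc (q (dn i j J)))).
    move=> ji; have ijV : [set i; j]%SET \in V by rewrite edge_in_vpairs eq_sym.
    rewrite (bernoulli_ibp p%:C%C (fun J => G J i j * conjc (q J)) ijV) mulr_sumr.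
    apply: eq_bigr => J _; rewrite mulrCA; congr (_ * (_ * _)).
    by rewrite rmorphM rmorphB rmorph1.
  under eq_bigr do under eq_bigr do rewrite ibp//.
  under eq_bigr do rewrite exchange_big /=.
  rewrite exchange_big -big_split /=; apply: eq_bigr => J _.
  have -> : \sum_i \sum_(j | j != i) wC J * (s2%:C%C *
      (G (up i j J) i j * conjc (q (up i j J)) - G (dn i j J) i j * conjc (q (dn i j J))))
    = wC J * (s2%:C%C * difference_sum J).
    rewrite !mulr_sumr; apply: eq_bigr => i _; rewrite !mulr_sumr.
    by apply: eq_bigr => j _.
  by ring.
have E0 : 0 <= E.
  by apply: sumr_ge0 => J _; rewrite mulr_ge0 ?bernoulli_weight_ge0 ?sqr_ge0.
rewrite -(ger0_norm E0) -normc_real EE (le_trans (normc_sum_le _ _ _))//.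
set M := _ + 2 * (n%:R * b) * B.
rewrite [leRHS](_ : M = \sum_(J : {set {set 'I_n}} | J \subset V)
    bernoulli_weight V p J * M); last by rewrite -mulr_suml bernoulli_weight_sum mul1r.
apply: ler_sum => J _.
rewrite normcM wCE normc_real ger0_norm ?bernoulli_weight_ge0//.
apply: ler_wpM2l; first exact: bernoulli_weight_ge0.
rewrite (le_trans (normcD_le _ _))// lerD//.
  rewrite normcM normc_real ger0_norm//.
  (* The factors s2 and p are bounded by 1, which makes the estimate uniform in p. *)
  have s2_1 : s2 <= 1 by rewrite (le_trans s21)//; lra.
  by rewrite -[leRHS]mul1r; apply: ler_pM; rewrite ?normc_ge0 ?difference_sum_le.
rewrite !normcM normc_real normc_conj ler_pM ?mulr_ge0 ?normc_ge0//.
move: p01 => /andP[p0 p1]; rewrite ger0_norm// -[leRHS]mul1r ler_pM ?normc_ge0//.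
Qed.

End Expectation.

(** * Spectrum and energy *)

Lemma char_poly_conj (K : fieldType) (n : nat) (P D : 'M[K]_n) : P \in unitmx ->
  char_poly (invmx P *m D *m P) = char_poly D.
Proof.
move=> Pu; pose Q := map_mx polyC P; pose Q' := map_mx polyC (invmx P).
have Q'Q : Q' *m Q = 1%:M by rewrite -map_mxM mulVmx// map_mx1.
rewrite /char_poly; have -> : char_poly_mx (invmx P *m D *m P) = Q' *m char_poly_mx D *m Q.
  rewrite /char_poly_mx !map_mxM mulmxBr mulmxBl; congr (_ - _).
  by rewrite mul_mx_scalar -scalemxAl Q'Q scalemx1.
by rewrite !det_mulmx mulrAC -det_mulmx Q'Q det1 mul1r.
Qed.

Section Spectrum.
Variables (R : rcfType) (n : nat) (A : 'M[R]_n).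
Hypothesis symA : A^T = A.
Local Notation M := (map_mx (real_complex R) A).

(** A real symmetric matrix is Hermitian over the complex numbers, and the spectral theorem for
    Hermitian matrices gives a real diagonal. *)
Lemma real_diagonalization : exists P : 'M[R[i]]_n, exists lam : 'I_n -> R,
  P \in unitmx /\ M = invmx P *m diag_mx (\row_i (lam i)%:C%C) *m P.
Proof.
have Mherm : M \is hermsymmx.
  apply: realsym_hermsym.
    by apply/is_hermitianmxP; rewrite expr0 scale1r map_mx_id// map_trmx symA.
  by apply/mxOverP => i j; rewrite mxE; apply/complex_realP; exists (A i j).
have /orthomx_spectralP ME := hermitian_normalmx Mherm.
exists (spectralmx M), (fun i => Re (spectral_diag M 0 i)); split.
  exact: spectral_unit.
rewrite {1}ME; congr (_ *m diag_mx _ *m _); apply/rowP => i; rewrite mxE RRe_real//.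
exact: (mxOverP (hermitian_spectral_diag_real Mherm)).
Qed.

(** One real list [lam] carries the energy, the Frobenius norm and the resolvent trace at once; from
    here on the spectral side is about real numbers only. *)
Lemma spectrum_exists : exists lam : 'I_n -> R,
  [/\ \sum_(z <- eigenvalues A) normc z = \sum_i `|lam i|,
      \sum_i lam i ^+ 2 = \sum_i \sum_j A i j ^+ 2 &
      forall theta, 0 < theta ->
        Im (\tr (resolvent A theta)) = \sum_i theta / (lam i ^+ 2 + theta ^+ 2)].
Proof.
have [P [lam [Pu ME]]] := real_diagonalization; exists lam; split.
- have charM : char_poly M = \prod_(z <- [seq (lam i)%:C%C | i : 'I_n]) ('X - z%:P).
    rewrite ME (char_poly_conj _ Pu) char_poly_trig ?diag_mx_is_trig//.
    by rewrite big_image; apply: eq_bigr => i _; rewrite !mxE eqxx.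
  (* [eigenvalues] is a chosen list of roots; unique factorisation of the characteristic polynomial
     identifies it with [lam] up to order. *)
  rewrite (perm_big [seq (lam i)%:C%C | i : 'I_n]) /=.
    by rewrite big_image; apply: eq_bigr => i _; rewrite normc_real.
  by apply: prod_XsubC_eq; rewrite -eigenvaluesP.
- apply: complexI; rewrite !rmorph_sum /=.
  transitivity (\tr (M *m M)).
    rewrite {2}ME {1}ME !mulmxA mulmxK// mxtrace_mulC !mulmxA mulmxV// mul1mx.
    by rewrite mulmx_diag mxtrace_diag; apply: eq_bigr => i _; rewrite !mxE rmorphXn expr2.
  apply: eq_bigr => i _; rewrite mxE rmorph_sum /=; apply: eq_bigr => j _.
  by rewrite !mxE rmorphXn /= expr2 -[in A j i]symA mxE.
- move=> theta theta0.
  have d0 i : (lam i)%:C%C - Complex 0 theta != 0.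
    by rewrite eq_complex /= !sub0r oppr_eq0 (gt_eqF theta0) andbF.
  pose d : 'rV[R[i]]_n := \row_i ((lam i)%:C%C - Complex 0 theta)^-1.
  have resE : resolvent A theta = invmx P *m diag_mx d *m P.
    have SE : shiftmx A theta *m (invmx P *m diag_mx d *m P) = 1%:M.
      have -> : shiftmx A theta =
          invmx P *m diag_mx (\row_i ((lam i)%:C%C - Complex 0 theta)) *m P.
        rewrite /shiftmx ME.
        have -> : \row_i ((lam i)%:C%C - Complex 0 theta) =
          \row_i (lam i)%:C%C - const_mx (Complex 0 theta) by apply/rowP => i; rewrite !mxE.
        rewrite linearB /= diag_const_mx mulmxBr mulmxBl; congr (_ - _).
        by rewrite mul_mx_scalar -scalemxAl mulVmx// scalemx1.
      rewrite !mulmxA mulmxK// -(mulmxA (invmx P)) mulmx_diag.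
      rewrite (_ : \row_j _ = const_mx 1) ?diag_const_mx ?mulmx1 ?mulVmx//.
      by apply/rowP => i; rewrite !mxE divff.
    by rewrite /resolvent -[RHS](mulKmx (shiftmx_unit symA theta0)) SE mulmx1.
  rewrite resE mxtrace_mulC mulmxA mulmxV// mul1mx mxtrace_diag raddf_sum /=.
  (* The imaginary part of 1 / (lam - i theta) is theta / (lam^2 + theta^2). *)
  apply: eq_bigr => i _; by rewrite mxE /= oppr0 !addr0 add0r sqrrN mulNr opprK.
Qed.

End Spectrum.

(** * Riemann sums of nonincreasing functions *)

Section AntitonePrimitive.
Variable R : realType.
Implicit Types (F f : R -> R).

(* A derivative-free way of saying that F is a primitive of the nonincreasing f. *)
Definition antitone_primitive F f :=
  forall s t : R, 0 <= s -> s < t -> (t - s) * f t <= F t - F s <= (t - s) * f s.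

(** The increment of F lies between the right and left Riemann sums, which differ by h (f 0 - f (N
    h)) <= h. *)
Lemma antitone_primitive_riemann F f h N : 0 < h -> 0 <= f (N%:R * h) -> f 0 <= 1 ->
  antitone_primitive F f ->
  `|F (N%:R * h) - F 0 - h * \sum_(k < N) f (k.+1%:R * h)| <= h.
Proof.
move=> h0 fN f0 Ff.
have step k : h * f (k.+1%:R * h) <= F (k.+1%:R * h) - F (k%:R * h) <= h * f (k%:R * h).
  have := Ff (k%:R * h) (k.+1%:R * h).
  have -> : k.+1%:R * h - k%:R * h = h by rewrite -mulrBl -natrB// subSnn mul1r.
  by apply; [rewrite mulr_ge0// ltW | rewrite ltr_pM2r// ltr_nat].
have tele : F (N%:R * h) - F 0 = \sum_(k < N) (F (k.+1%:R * h) - F (k%:R * h)).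
  by rewrite -(big_mkord xpredT (fun k => F (k.+1%:R * h) - F (k%:R * h)))
    telescope_sumr// mul0r.
have telf : \sum_(k < N) f (k%:R * h) =
    \sum_(k < N) f (k.+1%:R * h) + f 0 - f (N%:R * h).
  have : \sum_(k < N) (f (k.+1%:R * h) - f (k%:R * h)) = f (N%:R * h) - f 0.
    by rewrite -(big_mkord xpredT (fun k => f (k.+1%:R * h) - f (k%:R * h)))
      telescope_sumr// mul0r.
  by rewrite sumrB; lra.
have lo : h * \sum_(k < N) f (k.+1%:R * h) <= F (N%:R * h) - F 0.
  by rewrite tele mulr_sumr ler_sum// => k _; have /andP[] := step k.
have up : F (N%:R * h) - F 0 <= h * \sum_(k < N) f (k%:R * h).
  by rewrite tele mulr_sumr ler_sum// => k _; have /andP[] := step k.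
rewrite ger0_norm ?subr_ge0//; move: up; rewrite telf; nra.
Qed.

Lemma antitone_primitive_is_derive F f :
  (forall t : R, 0 <= t -> is_derive t 1 F (f t)) ->
  (forall s t : R, 0 <= s -> s <= t -> f t <= f s) -> antitone_primitive F f.
Proof.
move=> dF af s t s0 st.
have [c|c|c] := @MVT R F f s t st.
- rewrite in_itv /= => /andP[sc _]; apply: dF; exact: le_trans (ltW sc).
- apply: derivable_within_continuous => x; rewrite in_itv /= => /andP[sx _].
  by have [] := dF x (le_trans s0 sx).
rewrite in_itv /= => /andP[sc ct] ->.
rewrite ![f c * _]mulrC !ler_pM2l ?subr_gt0//.
by rewrite (af c t (le_trans s0 (ltW sc)) (ltW ct)) (af s c s0 (ltW sc)).
Qed.

Lemma antitone_primitive_mean (n : nat) (F f : 'I_n -> R -> R) :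
  (forall i, antitone_primitive (F i) (f i)) ->
  antitone_primitive (fun t => (\sum_i F i t) / n%:R) (fun t => (\sum_i f i t) / n%:R).
Proof.
move=> Ff s t s0 st.
rewrite -mulrBl -sumrB !mulrA -[(t - s) * _]/((t - s) * _) !mulr_sumr.
by rewrite !ler_wpM2r ?invr_ge0 ?ler_sum// => i _; have /andP[] := Ff i s t s0 st.
Qed.

End AntitonePrimitive.

(** * The integral that recovers an absolute value *)

Section Arctangent.
Variable R : realType.
Implicit Types x t mu : R.

Lemma atan_le x : 0 <= x -> atan x <= x.
Proof.
rewrite le_eqVlt => /predU1P[<-|x0]; first by rewrite atan0.
have [c|c _] := @MVT R atan (fun y => (1 + y ^+ 2)^-1) 0 x x0.
  by move: c; apply: continuous_subspaceT => y; exact: continuous_atan.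
rewrite atan0 !subr0 => ->; rewrite -[leRHS]mul1r ler_pM2r//.
by rewrite invf_le1 ?lerDl ?sqr_ge0// ltr_pwDl ?sqr_ge0.
Qed.

(** The difference is the arctangent of 1 / x, and atan y <= y. *)
Lemma pihalf_sub_atan_le x : 0 < x -> 0 <= pi / 2 - atan x <= x^-1.
Proof.
move=> x0; apply/andP; split; first by rewrite subr_ge0 ltW// atan_ltpi2.
have a0 : 0 < atan x by rewrite -atan0 lt_atan.
have -> : pi / 2 - atan x = atan x^-1.
  rewrite -[LHS]tanK ?in_itv /=; last first.
    have := atan_ltpi2 x; have := pi_gt0 R; lra.
  congr atan; rewrite -[in RHS](atanK x) /tan invf_div.
  by rewrite addrC sinDpihalf cosDpihalf sinN cosN opprK.
by rewrite atan_le// invr_ge0 ltW.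
Qed.

(** The primitive in t of mu^2 / (mu^2 + t^2) vanishing at 0; its limit at infinity is |mu| pi /
    2. *)
Definition abs_atan mu t := if mu == 0 then 0 else `|mu| * atan (t / `|mu|).

Lemma abs_atan0 mu : abs_atan mu 0 = 0.
Proof. by rewrite /abs_atan mul0r atan0 mulr0 if_same. Qed.

Lemma abs_atan_tail mu t : 0 < t -> 0 <= `|mu| * (pi / 2) - abs_atan mu t <= mu ^+ 2 / t.
Proof.
move=> t0; rewrite /abs_atan; have [->|mu0] := eqVneq mu 0.
  by rewrite normr0 mul0r subrr lexx expr0n mul0r /=.
have m0 : 0 < `|mu| by rewrite normr_gt0.
rewrite -mulrBr; have /andP[lo up] := pihalf_sub_atan_le (divr_gt0 t0 m0).
rewrite mulr_ge0//= (le_trans (ler_wpM2l _ up))// invf_div mulrA.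
by rewrite -expr2 real_normK ?num_real.
Qed.

Lemma abs_atan_primitive mu :
  antitone_primitive (abs_atan mu) (fun t => mu ^+ 2 / (mu ^+ 2 + t ^+ 2)).
Proof.
have [->|mu0] := eqVneq mu 0.
  by move=> s t _ _; rewrite /abs_atan eqxx expr0n /= !mul0r !mulr0 subr0 lexx.
have m2 : 0 < mu ^+ 2 by rewrite exprn_even_gt0.
have den t : 0 < mu ^+ 2 + t ^+ 2 by rewrite ltr_pwDl// sqr_ge0.
apply: antitone_primitive_is_derive => [t t0|s t s0 st]; last first.
  by rewrite ler_pM2l// lef_pV2 ?posrE// lerD2l ler_pXn2r// nnegrE (le_trans s0).
have m0 : `|mu| != 0 by rewrite normr_eq0.
have -> : abs_atan mu = `|mu| \*: (atan \o (fun u => u * `|mu|^-1)).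
  by apply/funext => u; rewrite /abs_atan (negbTE mu0).
have d1 : is_derive t 1 (fun u : R => u * `|mu|^-1) (`|mu|^-1).
  have -> : (fun u : R => u * `|mu|^-1) = `|mu|^-1 *: (id : R -> R).
    by apply/funext => u; rewrite /= mulrC.
  by apply: is_derive_eq; rewrite scaler1.
have d2 := @is_derive1_comp R atan (fun u => u * `|mu|^-1) t _ _ (is_derive1_atan _) d1.
apply: (is_derive_eq (is_deriveZ `|mu| d2)).
rewrite /GRing.scale /=.
have mu2 : mu ^+ 2 = `|mu| ^+ 2 by rewrite real_normK ?num_real.
have := den t; rewrite mu2 => /gt_eqF den0; field.
by rewrite m0 /= den0.
Qed.

End Arctangent.

(** * The first absolute moment of the semicircle law *)

Section SemicircleLaw.
Variable R : realType.
Implicit Types t : R.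

(* The integral of x^2 / (x^2 + t^2) against the semicircle law of variance s2
   (the junk value 1 at t = s2 = 0 is harmless). *)
Definition semicircle_profile (s2 : R) t := 1 - 2 * t / (t + Num.sqrt (t ^+ 2 + 4 * s2)).

Lemma semicircle_profile_ge0 (s2 : R) t : 0 <= s2 -> 0 <= t -> 0 <= semicircle_profile s2 t.
Proof.
move=> s20 t0; rewrite subr_ge0; have [->|t1] := eqVneq t 0.
  by rewrite mulr0 mul0r.
have tp : 0 < t by rewrite lt_def t1.
have tr : t <= Num.sqrt (t ^+ 2 + 4 * s2).
  by rewrite -[leLHS]ger0_norm// -sqrtr_sqr ler_wsqrtr// lerDl mulr_ge0.
rewrite ler_pdivrMr; first by lra.
by rewrite ltr_pwDl// sqrtr_ge0.
Qed.

(** With r the square root, the claim is s r(t) <= t r(s), which after squaring reduces to s^2 <=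
    t^2. *)
Lemma semicircle_profile_anti (s2 s : R) t : 0 < s2 -> 0 <= s -> s <= t ->
  semicircle_profile s2 t <= semicircle_profile s2 s.
Proof.
move=> s20 s0 st; have t0 := le_trans s0 st.
rewrite lerD2l lerN2 -!mulrA ler_pM2l//.
have rp u : 0 < Num.sqrt (u ^+ 2 + 4 * s2).
  by rewrite sqrtr_gt0 ltr_wpDl ?sqr_ge0// mulr_gt0.
rewrite ler_pdivrMr ?ltr_wpDl// mulrAC ler_pdivlMr ?ltr_wpDl//.
rewrite !mulrDr [s * t]mulrC lerD2l.
rewrite -(@ler_pXn2r _ 2)// ?nnegrE ?mulr_ge0 ?sqrtr_ge0//.
have r2 u : Num.sqrt (u ^+ 2 + 4 * s2) ^+ 2 = u ^+ 2 + 4 * s2.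
  by rewrite sqr_sqrtr// addr_ge0 ?sqr_ge0// mulr_ge0// ltW.
rewrite !exprMn !r2 ![_ ^+ 2 * (_ + _)]mulrDr [s ^+ 2 * t ^+ 2]mulrC lerD2l.
by rewrite ler_pM2r ?mulr_gt0// ler_pXn2r.
Qed.

(** For s2 > 0 the primitive is t + (t^3 - r^3) / (6 s2) with r = sqrt(t^2 + 4 s2), normalised to
    vanish at infinity. Hence - F 0 is the full integral: pi / 2 times the absolute moment 8
    sqrt(s2) / (3 pi). *)
Lemma semicircle_primitive (s2 : R) : 0 <= s2 -> s2 <= 1 / 4 -> exists F : R -> R,
  [/\ antitone_primitive F (semicircle_profile s2), F 0 = - (4 / 3 * Num.sqrt s2) &
      forall t, 0 < t -> `|F t| <= 1 / (3 * t)].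
Proof.
rewrite le_eqVlt => /predU1P[<-|s20] s21.
  (* For s2 = 0 the profile vanishes at every t > 0. Its value 1 at 0 enters only the upper bound,
     where nonnegativity suffices. *)
  exists (fun=> 0); split; last by move=> t t0; rewrite normr0 divr_ge0// mulr_ge0// ltW.
  - move=> s t s0 st; rewrite subrr; apply/andP; split; last first.
      by apply: mulr_ge0; [rewrite subr_ge0 ltW|exact: semicircle_profile_ge0].
    have t0 := le_lt_trans s0 st.
    rewrite /semicircle_profile mulr0 addr0 sqrtr_sqr gtr0_norm//.
    have -> : 1 - 2 * t / (t + t) = 0 by field; rewrite gt_eqF// addr_gt0.
    by rewrite mulr0.
  - by rewrite sqrtr0 mulr0 oppr0.
pose r t := Num.sqrt (t ^+ 2 + 4 * s2).
have rp t : 0 < r t by rewrite sqrtr_gt0 ltr_wpDl ?sqr_ge0// mulr_gt0.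
have r2 t : r t ^+ 2 = t ^+ 2 + 4 * s2.
  by rewrite sqr_sqrtr// addr_ge0 ?sqr_ge0// mulr_ge0// ltW.
have tr t : 0 <= t -> t < r t.
  move=> t0; rewrite -(@ltr_pXn2r _ 2)// ?nnegrE// ?ltW//.
  by rewrite r2 ltrDl mulr_gt0.
have s2E t : s2 = (r t ^+ 2 - t ^+ 2) / 4 by rewrite r2; field.
exists (fun t => t + (t ^+ 3 - r t ^+ 3) / (6 * s2)); split.
- apply: antitone_primitive_is_derive; last by move=> s t; exact: semicircle_profile_anti.
  move=> t t0.
  have dr : is_derive t 1 r (t / r t).
    have d1 : is_derive t 1 (fun u : R => u ^+ 2 + 4 * s2) (2 * t).
      have -> : (fun u : R => u ^+ 2 + 4 * s2) = ((id : R -> R) ^+ 2 + cst (4 * s2)).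
        by apply/funext => u.
      apply: is_derive_eq; rewrite addr0 /GRing.scale /=; ring.
    have u0 : 0 < t ^+ 2 + 4 * s2 by rewrite ltr_wpDl ?sqr_ge0// mulr_gt0.
    apply: (is_derive_eq (@is_derive1_comp R Num.sqrt _ t _ _ (is_derive1_sqrt u0) d1)).
    by rewrite -/(r t); field; rewrite gt_eqF.
  have -> : (fun u : R => u + (u ^+ 3 - r u ^+ 3) / (6 * s2)) =
     (id : R -> R) + (6 * s2)^-1 \*: ((id : R -> R) ^+ 3 - r ^+ 3).
    by apply/funext => u; rewrite /= mulrC.
  apply: is_derive_eq; rewrite /GRing.scale /= /semicircle_profile -/(r t).
  have := tr _ t0; have := rp t; rewrite {1}(s2E t); move: (r t) => q q0 tq.
  have qt2 : 0 < q ^+ 2 - t ^+ 2 by rewrite subr_sqr mulr_gt0 ?subr_gt0// ltr_wpDr// ltW.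
  by field; rewrite (gt_eqF q0) (gt_eqF qt2) gt_eqF// ltr_wpDl.
- rewrite expr0n add0r sub0r /r expr0n add0r.
  rewrite sqrtrM// (_ : 4 = 2 ^+ 2); last by ring.
  rewrite sqrtr_sqr ger0_norm//.
  have : Num.sqrt s2 ^+ 2 = s2 by rewrite sqr_sqrtr// ltW.
  have : 0 < Num.sqrt s2 by rewrite sqrtr_gt0.
  by move: (Num.sqrt s2) => q q0 <-; field; rewrite gt_eqF.
- move=> t t0; have qt := tr _ (ltW t0); have q0 := rp t.
  have rt : (r t - t) * (r t + t) = 4 * s2.
    by rewrite -subr_sqr r2 addrAC subrr add0r.
  (* Substituting s2 = (r^2 - t^2) / 4 cancels a factor r - t and displays the decay at infinity. *)
  have -> : t + (t ^+ 3 - r t ^+ 3) / (6 * s2) = - ((r t - t) * ((t + 2 * r t) / (3 * (t + r t)))).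
    rewrite {1}(s2E t); move: (r t) qt q0 => q qt q0.
    have qt2 : 0 < q ^+ 2 - t ^+ 2.
      by rewrite subr_sqr mulr_gt0 ?subr_gt0// addr_gt0.
    by field; rewrite (gt_eqF qt2) gt_eqF// addr_gt0.
  rewrite normrN ger0_norm; last first.
    rewrite mulr_ge0 ?subr_ge0 ?(ltW qt)// ltW// divr_gt0//.
      by rewrite addr_gt0// mulr_gt0.
    by rewrite mulr_gt0// addr_gt0.
  (* This follows from (r - t)^2 + 2 t (r - t) = (r - t) (r + t) = 4 s2 <= 1. *)
  have le1 : (r t - t) * t <= 1 / 2.
    have : 0 <= (r t - t) ^+ 2 by rewrite sqr_ge0.
    by nra.
  have le2 : (t + 2 * r t) / (3 * (t + r t)) <= 2 / 3.
    by rewrite ler_pdivrMr ?mulr_gt0 ?addr_gt0//; lra.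
  rewrite ler_pdivlMr ?mulr_gt0//.
  have -> : (r t - t) * ((t + 2 * r t) / (3 * (t + r t))) * (3 * t) =
    (r t - t) * t * ((t + 2 * r t) / (3 * (t + r t))) * 3 by ring.
  rewrite [leRHS](_ : 1 = 1 / 2 * (2 / 3) * 3); last by field.
  rewrite ler_pM2r// ler_pM//.
    by apply: mulr_ge0; rewrite ?subr_ge0 ltW.
  by rewrite ltW// divr_gt0 ?mulr_gt0 ?addr_gt0// mulr_gt0.
Qed.

(** Both quantities are integrals over t > 0 of nonincreasing functions bounded by 1. For each of
    them truncation at T = N h costs at most 1 / T and discretisation at most h; the integrands are
    then compared at N points. *)
Lemma mean_abs_semicircle (n : nat) (mu : 'I_n -> R) (s2 h : R) (N : nat) :
  (0 < n)%N -> (0 < N)%N -> 0 < h -> 0 <= s2 -> s2 <= 1 / 4 ->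
  \sum_i mu i ^+ 2 <= n%:R ->
  `|(\sum_i `|mu i|) / n%:R * (pi / 2) - 4 / 3 * Num.sqrt s2| <=
  2 / (N%:R * h) + 2 * h + h * \sum_(k < N)
    `|(\sum_i mu i ^+ 2 / (mu i ^+ 2 + (k.+1%:R * h) ^+ 2)) / n%:R
      - semicircle_profile s2 (k.+1%:R * h)|.
Proof.
move=> n0 N0 h0 s20 s21 mun.
have nR : 0 < n%:R :> R by rewrite ltr0n.
set T := N%:R * h; have T0 : 0 < T by rewrite mulr_gt0// ltr0n.
pose Phi t := (\sum_i abs_atan (mu i) t) / n%:R.
pose v t := (\sum_i mu i ^+ 2 / (mu i ^+ 2 + t ^+ 2)) / n%:R.
have Phiv : antitone_primitive Phi v.
  by apply: antitone_primitive_mean => i; exact: abs_atan_primitive.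
have [Psi [Psiv Psi0 PsiT]] := semicircle_primitive s20 s21.
have vT : 0 <= v T.
  rewrite divr_ge0 ?ler0n ?sumr_ge0// => i _.
  by rewrite divr_ge0 ?addr_ge0 ?sqr_ge0.
have v0 : v 0 <= 1.
  have -> : 1 = (\sum_(i < n) 1) / n%:R :> R by rewrite sumr_const card_ord divff// gt_eqF.
  rewrite ler_pM2r ?invr_gt0//.
  apply: ler_sum => i _; rewrite expr0n addr0.
  by have [->|m0] := eqVneq (mu i) 0; rewrite ?expr0n ?mul0r// divff// expf_neq0.
have w0 : semicircle_profile s2 0 <= 1 by rewrite /semicircle_profile mulr0 mul0r subr0.
have wT : 0 <= semicircle_profile s2 T by rewrite semicircle_profile_ge0// ltW.
have R1 := antitone_primitive_riemann h0 vT v0 Phiv.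
have R2 := antitone_primitive_riemann h0 wT w0 Psiv.
have Phi0 : Phi 0 = 0.
  by rewrite /Phi big1 ?mul0r// => i _; rewrite abs_atan0.
have /andP[tail0 tail1] : 0 <= (\sum_i `|mu i|) / n%:R * (pi / 2) - Phi T <= 1 / T.
  have -> : (\sum_i `|mu i|) / n%:R * (pi / 2) - Phi T =
     (\sum_i (`|mu i| * (pi / 2) - abs_atan (mu i) T)) / n%:R.
    by rewrite /Phi sumrB -mulr_suml mulrBl; congr (_ - _); rewrite mulrAC.
  apply/andP; split.
    by rewrite divr_ge0 ?ler0n ?sumr_ge0// => i _; have /andP[] := abs_atan_tail (mu i) T0.
  rewrite ler_pdivrMr//.
  have le i : `|mu i| * (pi / 2) - abs_atan (mu i) T <= mu i ^+ 2 / T.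
    by have /andP[] := abs_atan_tail (mu i) T0.
  rewrite (le_trans (ler_sum _ (fun i _ => le i)))// -mulr_suml mul1r mulrC.
  by rewrite ler_pM2l ?invr_gt0.
have PT := PsiT _ T0.
have PT' : 1 / (3 * T) <= 1 / T.
  have -> : 1 / (3 * T) = 1 / 3 * (1 / T) by field; rewrite gt_eqF.
  have : 0 < 1 / T by rewrite divr_gt0.
  by move: (1 / T) => x; lra.
have sum_le : `|h * \sum_(k < N) v (k.+1%:R * h)
               - h * \sum_(k < N) semicircle_profile s2 (k.+1%:R * h)| <=
  h * \sum_(k < N) `|v (k.+1%:R * h) - semicircle_profile s2 (k.+1%:R * h)|.
  by rewrite -mulrBr -sumrB normrM gtr0_norm// ler_pM2l// ler_norm_sum.
rewrite -/T in R1 R2.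
move: R1 R2 PT PT' sum_le; rewrite Psi0 Phi0 !ler_norml.
move=> /andP[? ?] /andP[? ?] /andP[? ?] ? /andP[? ?].
have -> : 2 / T = 1 / T + 1 / T by field; rewrite gt_eqF.
by apply/andP; split; lra.
Qed.

End SemicircleLaw.

(** * From the quadratic equation to the semicircle profile *)

Section Link.
Variable R : realType.

(** With U the subtracted fraction, i U is a root and the quadratic factors as (S - i U) (s2 (S + i
    U) + i theta). The second factor has imaginary part at least theta, since Im S >= 0. Writing U
    with the square root in the denominator keeps it valid at s2 = 0. *)
Lemma semicircle_poly_stable (n : nat) (theta s2 : R) (S : R[i]) :
  0 < theta -> 0 <= s2 -> 0 <= Im S ->
  theta * `|Im S - 2 * n%:R / (theta + Num.sqrt (theta ^+ 2 + 4 * (n%:R * s2)))|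
    <= normc (semicircle_poly n theta s2 S).
Proof.
move=> theta0 s20 ImS; set r := Num.sqrt _; set U := _ / (theta + r).
have tr : 0 < theta + r by rewrite ltr_pwDl// sqrtr_ge0.
have U0 : 0 <= U by rewrite divr_ge0 ?mulr_ge0// ltW.
have rootU : n%:R - theta * U - s2 * U ^+ 2 = 0.
  have : r ^+ 2 = theta ^+ 2 + 4 * (n%:R * s2).
    by rewrite sqr_sqrtr// addr_ge0 ?sqr_ge0// !mulr_ge0.
  move=> r2; have : (n%:R - theta * U - s2 * U ^+ 2) * (theta + r) ^+ 2 = 0.
    rewrite /U; transitivity (n%:R * (r ^+ 2 - theta ^+ 2 - 4 * (n%:R * s2))).
      by field; rewrite gt_eqF.
    by rewrite r2; ring.
  by move/eqP; rewrite mulf_eq0 (gt_eqF (exprn_gt0 2 tr)) orbF => /eqP.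
have -> : semicircle_poly n theta s2 S =
    (S - Complex 0 U) * (s2%:C%C * (S + Complex 0 U) + Complex 0 theta).
  have -> : semicircle_poly n theta s2 S =
     semicircle_poly n theta s2 S - (n%:R - theta * U - s2 * U ^+ 2)%:C%C.
    by rewrite rootU subr0.
  rewrite /semicircle_poly -(rmorph_nat (real_complex R)) /=.
  case: S ImS => x y _; apply/eqP; rewrite eq_complex /= !expr2 /=.
  by apply/andP; split; apply/eqP; ring.
rewrite normcM mulrC; apply: ler_pM; [exact: normr_ge0|exact: ltW| |].
  by apply: le_trans (Im_le_normc _); case: S ImS.
apply: le_trans (Im_le_normc _); case: S ImS => x y /= y0.
rewrite mul0r addr0 (le_trans _ (ler_norm _))// lerDr.
by rewrite mulr_ge0// addr_ge0.
Qed.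

(** Since lam^2 / (lam^2 + theta^2) = 1 - theta^2 / (lam^2 + theta^2), the spectral average is 1 -
    theta Im S / n. The profile is 1 - theta U / n, with U from the stability lemma. *)
Lemma profile_difference_le (n : nat) (lam : 'I_n -> R) (t s2 : R) (S : R[i]) :
  let theta := t * Num.sqrt n%:R in
  (0 < n)%N -> 0 < t -> 0 <= s2 ->
  Im S = \sum_i theta / (lam i ^+ 2 + theta ^+ 2) ->
  `|(\sum_i (lam i / Num.sqrt n%:R) ^+ 2 / ((lam i / Num.sqrt n%:R) ^+ 2 + t ^+ 2)) / n%:R
      - semicircle_profile s2 t| <= normc (semicircle_poly n theta s2 S) / n%:R.
Proof.
move=> /= n0 t0 s20; have nR : 0 < n%:R :> R by rewrite ltr0n.
set w := Num.sqrt n%:R; set theta := t * w => ImSE; have w0 : 0 < w by rewrite sqrtr_gt0.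
have w2 : w ^+ 2 = n%:R by rewrite sqr_sqrtr// ltW.
have theta0 : 0 < theta by rewrite mulr_gt0.
have ImS : 0 <= Im S.
  by rewrite ImSE sumr_ge0// => i _; rewrite divr_ge0 ?addr_ge0 ?sqr_ge0// ltW.
apply: le_trans (ler_wpM2r _ (semicircle_poly_stable n theta0 s20 ImS)); last first.
  by rewrite invr_ge0 ltW.
set U := 2 * n%:R / _; set X := _ - semicircle_profile _ _.
suff -> : X = - (theta * (Im S - U) / n%:R).
  by rewrite normrN normf_div normrM (gtr0_norm theta0) (gtr0_norm nR).
rewrite /X /U {X U}.
have -> : Num.sqrt (theta ^+ 2 + 4 * (n%:R * s2)) = w * Num.sqrt (t ^+ 2 + 4 * s2).
  have -> : theta ^+ 2 + 4 * (n%:R * s2) = n%:R * (t ^+ 2 + 4 * s2).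
    by rewrite /theta exprMn w2; ring.
  by rewrite sqrtrM// ltW.
have -> : \sum_i (lam i / w) ^+ 2 / ((lam i / w) ^+ 2 + t ^+ 2) = n%:R - theta * Im S.
  have -> : n%:R = \sum_(i < n) 1 :> R by rewrite sumr_const card_ord.
  rewrite ImSE mulr_sumr -sumrB; apply: eq_bigr => i _; rewrite /theta.
  have d0 : 0 < lam i ^+ 2 + (t * w) ^+ 2 by rewrite ltr_wpDl ?sqr_ge0// exprn_gt0// mulr_gt0.
  have := d0; rewrite exprMn => d1.
  by field; rewrite ?(gt_eqF w0) ?andbT /= -?exprMn ?(gt_eqF d0) ?(gt_eqF d1).
rewrite /semicircle_profile; set r := Num.sqrt _.
have tr : 0 < t + r by rewrite ltr_pwDl// sqrtr_ge0.
have -> : theta + w * r = w * (t + r) by rewrite /theta; ring.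
rewrite /theta -w2; field.
by rewrite (gt_eqF w0) (gt_eqF tr).
Qed.

End Link.

(** * Energy of the random graph *)

Section Energy.
Variable R : realType.

Definition self_consistency_defect (n : nat) (p t : R) (G : sgraph n) : R :=
  normc (semicircle_poly n (t * Num.sqrt n%:R) (p * (1 - p))
           (\tr (resolvent (adjmx R G) (t * Num.sqrt n%:R)))) / n%:R.

Lemma powR_neg_three_halves (n : nat) : (0 < n)%N ->
  n%:R `^ (- (3 / 2)) = (Num.sqrt n%:R)^-1 / n%:R :> R.
Proof.
move=> n0; have -> : (3 / 2 : R) = 1 + 2^-1 by field.
rewrite powRN powRD; last by rewrite pnatr_eq0 -lt0n n0 implybT.
by rewrite powRr1// powR12_sqrt// invfM mulrC.
Qed.

Lemma bernoulli_variance (p : R) : 0 <= p <= 1 -> 0 <= p * (1 - p) <= 1 / 4.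
Proof.
move=> /andP[p0 p1]; apply/andP; split; first by rewrite mulr_ge0// subr_ge0.
by have := sqr_ge0 (p - 1 / 2); lra.
Qed.

Lemma adjmx_sqr_sum_le (n : nat) (G : sgraph n) :
  \sum_i \sum_j adjmx R G i j ^+ 2 <= n%:R * n%:R.
Proof.
have -> : n%:R * n%:R = \sum_(i < n) \sum_(j < n) 1 :> R.
  by rewrite !sumr_const !card_ord -natrM mulrnA.
apply: ler_sum => i _; apply: ler_sum => j _; rewrite mxE.
by case: (_ \in _); rewrite ?expr1n// expr0n.
Qed.

(** A deterministic estimate, valid for every graph: all randomness is left in finitely many
    defects. The eigenvalues are rescaled by sqrt n, and their mean square is at most 1 because the
    entries are 0 or 1. *)
Lemma energy_deviation_le (n : nat) (p h : R) (N : nat) (G : sgraph n) :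
  (0 < n)%N -> (0 < N)%N -> 0 < h -> 0 <= p <= 1 ->
  `|n%:R `^ (- (3 / 2)) * energy R G - 8 / (3 * pi) * Num.sqrt (p * (1 - p))|
  <= 2 / (N%:R * h) + 2 * h
     + h * \sum_(k < N) self_consistency_defect p (k.+1%:R * h) G.
Proof.
move=> n0 N0 h0 p01; have /andP[s20 s21] := bernoulli_variance p01.
have nR : 0 < n%:R :> R by rewrite ltr0n.
have symA : (adjmx R G)^T = adjmx R G := set_adjmx_sym R (edges G).
have [lam [lamE lam2 lamIm]] := spectrum_exists symA.
set w : R := Num.sqrt n%:R; have w0 : 0 < w by rewrite sqrtr_gt0.
have w2 : w ^+ 2 = n%:R by rewrite sqr_sqrtr// ltW.
pose mu i := lam i / w.
have mu2 : \sum_i mu i ^+ 2 <= n%:R.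
  have -> : \sum_i mu i ^+ 2 = (\sum_i lam i ^+ 2) / n%:R.
    by rewrite mulr_suml; apply: eq_bigr => i _; rewrite expr_div_n w2.
  by rewrite ler_pdivrMr// lam2 adjmx_sqr_sum_le.
have := mean_abs_semicircle n0 N0 h0 s20 s21 mu2.
set sg := Num.sqrt (p * (1 - p)).
have -> : n%:R `^ (- (3 / 2)) * energy R G = (\sum_i `|mu i|) / n%:R.
  rewrite powR_neg_three_halves// /energy lamE mulrAC; congr (_ / _).
  rewrite mulr_sumr; apply: eq_bigr => i _.
  by rewrite normrM normfV (gtr0_norm w0) mulrC.
move: (_ / n%:R) (@pi R) (pi_ge2 R) => a P P2 main.
have P0 : 0 < P by lra.
have -> : a - 8 / (3 * P) * sg = (a * (P / 2) - 4 / 3 * sg) / (P / 2).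
  by field; rewrite gt_eqF.
(* As pi >= 2, dividing by pi / 2 does not enlarge the error. *)
have Phalf : 1 <= P / 2 by lra.
rewrite normf_div [`|P / 2|]ger0_norm; last by lra.
rewrite (@le_trans _ _ `|a * (P / 2) - 4 / 3 * sg|)//.
  by rewrite ler_pdivrMr ?ler_peMr//; lra.
apply: le_trans main _; rewrite lerD2l ler_pM2l//; apply: ler_sum => k _.
have kh : 0 < k.+1%:R * h by rewrite mulr_gt0// ltr0Sn.
apply: profile_difference_le => //.
by rewrite lamIm// mulr_gt0.
Qed.

(** The bound of [expectation_semicircle_poly_le] at n = 1 and theta = t. *)
Definition defect_constant (t : R) : R :=
  let c := t^-1 in let B := 2 + c ^+ 2 / 4 in
  4 * c ^+ 3 * B + c * (2 * c + c ^+ 3) + c ^+ 2 * B + 2 * c * B.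

Lemma defect_constant_ge0 t : 0 < t -> 0 <= defect_constant t.
Proof.
move=> t0; have c0 : 0 <= t^-1 by rewrite invr_ge0 ltW.
rewrite /defect_constant; move: t^-1 c0 => c c0 /=.
have B0 : 0 <= 2 + c ^+ 2 / 4 by rewrite addr_ge0// divr_ge0// exprn_ge0.
by rewrite !addr_ge0 ?mulr_ge0 ?addr_ge0 ?mulr_ge0 ?exprn_ge0.
Qed.

Lemma expectation_defect_le (n : nat) (p t : R) : (0 < n)%N -> 0 <= p <= 1 -> 0 < t ->
  \sum_(G : sgraph n) Gnp_weight p G * self_consistency_defect p t G ^+ 2
  <= defect_constant t / Num.sqrt n%:R.
Proof.
move=> n0 p01 t0; have nR : 0 < n%:R :> R by rewrite ltr0n.
set w : R := Num.sqrt n%:R; have w0 : 0 < w by rewrite sqrtr_gt0.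
have w2 : n%:R = w ^+ 2 by rewrite sqr_sqrtr// ltW.
have theta0 : 0 < t * w by rewrite mulr_gt0.
pose F (J : {set {set 'I_n}}) := (normc (semicircle_poly n (t * w) (p * (1 - p))
           (\tr (resolvent (set_adjmx R J) (t * w)))) / n%:R) ^+ 2.
rewrite [leLHS](sum_sgraph F p) /F.
under eq_bigr do rewrite expr_div_n mulrA.
rewrite -mulr_suml ler_pdivrMr ?exprn_gt0//.
rewrite (le_trans (expectation_semicircle_poly_le n theta0 p01))//.
rewrite /sp_bound /sp_step /defect_constant invfM.
have s0 : 0 < w^-1 by rewrite invr_gt0.
have s1 : w^-1 <= 1.
  have w21 : 1 <= w ^+ 2 by rewrite -w2 ler1n.
  by rewrite invf_le1//; move: w0 w21; clear; nra.
have c0 : 0 <= t^-1 by rewrite invr_ge0 ltW.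
(* Everything is expressed in s = 1 / sqrt n. After division by n^2 each term carries s or s^2, and
   s <= 1 leaves a single factor s. *)
have -> : n%:R = w^-1 ^- 2 by rewrite w2 exprVn invrK.
move: t^-1 w^-1 c0 s0 s1 => c s c0 s0 s1 /=.
pose B := 2 + c ^+ 2 / 4.
have B0 : 0 <= B by rewrite addr_ge0// divr_ge0// exprn_ge0.
have le (x : R) : 0 <= x -> x * s <= x by move=> x0; rewrite ler_piMr.
rewrite -ler_pdivrMr; last by rewrite exprn_gt0// invr_gt0 exprn_gt0.
have -> : (s ^- 2 ^+ 2 * (4 * (c * s) ^+ 3 * (2 * s ^- 2 + s ^- 2 ^+ 2 * (c * s) ^+ 2 / 4) +
   c * s * (2 * (c * s) + s ^- 2 * (c * s) ^+ 3)) +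
   s ^- 2 * (c * s) ^+ 2 * (2 * s ^- 2 + s ^- 2 ^+ 2 * (c * s) ^+ 2 / 4) +
   2 * (s ^- 2 * (c * s)) * (2 * s ^- 2 + s ^- 2 ^+ 2 * (c * s) ^+ 2 / 4)) / s ^- 2 ^+ 2
   = (4 * c ^+ 3 * B + (c * (2 * c + c ^+ 3)) * s + c ^+ 2 * B * s + 2 * c * B) * s.
  by rewrite /B; field; rewrite gt_eqF.
rewrite -/B ler_pM2r// !lerD// le// ?mulr_ge0 ?addr_ge0 ?mulr_ge0 ?exprn_ge0//.
Qed.

(** Markov's inequality, with f a nonnegative majorant of the indicator that Q fails. *)
Lemma Gnp_markov (n : nat) (p : R) (Q : pred (sgraph n)) (f : sgraph n -> R) :
  0 <= p <= 1 -> (forall G, 0 <= f G) -> (forall G, ~~ Q G -> 1 <= f G) ->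
  1 - \sum_(G : sgraph n) Gnp_weight p G * f G <= Gnp_Pr p Q <= 1.
Proof.
move=> p01 f0 f1; have w0 G := Gnp_weight_ge0 G p01.
rewrite -(Gnp_weight_sum n p) [X in X - _](bigID Q) /= /Gnp_Pr.
apply/andP; split; last first.
  by rewrite [leRHS](bigID Q) /= lerDl sumr_ge0.
rewrite lerBlDr lerD2l [leRHS](bigID Q) /= ler_wpDl ?sumr_ge0// => [G _|].
  by rewrite mulr_ge0.
by apply: ler_sum => G nQ; rewrite ler_peMr// f1.
Qed.

End Energy.

Theorem mainTheorem1 (R : realType) (p : nat -> R)
    (hp : forall n : nat, 0 <= p n <= 1) :
  almost_every_o1 p (fun (n : nat) (G : sgraph n) =>
    n%:R `^ (- (3 / 2)) * energy R G
      - 8 / (3 * pi) * Num.sqrt (p n * (1 - p n))).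
Proof.
move=> eps eps0; rewrite /almost_every.
(* Here 2 h = eps / 8, and N is taken so large that 2 / (N h) <= eps / 8. Neither depends on n. *)
pose h := eps / 16; have h0 : 0 < h by rewrite divr_gt0.
pose N := (Num.truncn (16 / (eps * h))).+1.
have NR : 0 < N%:R :> R by rewrite ltr0n.
have Nh : 0 < N%:R * h by rewrite mulr_gt0.
have mesh : 2 / (N%:R * h) + 2 * h <= eps / 4.
  have : 2 / (N%:R * h) <= eps / 8.
    have : 16 / (eps * h) < N%:R by exact: truncnS_gt.
    rewrite ltr_pdivrMr ?mulr_gt0// => lt; rewrite ler_pdivrMr//.
    by move: lt; rewrite mulrCA; lra.
  by rewrite /h; lra.
(* Chosen so that N terms delta with weight h add up to eps / 4. *)
pose delta := eps / (4 * (N%:R * h)).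
have delta0 : 0 < delta by rewrite divr_gt0// mulr_gt0.
(* If the deviation exceeds eps, then h / delta times the sum of squared defects is at least eps /
   2; the factor 2 / eps normalises this to 1. *)
pose f n (G : sgraph n) : R :=
  2 * h / (eps * delta) * \sum_(k < N) self_consistency_defect (p n) (k.+1%:R * h) G ^+ 2.
pose K := 2 * h / (eps * delta) * \sum_(k < N) defect_constant (k.+1%:R * h).
have a0 : 0 < 2 * h / (eps * delta) by apply: divr_gt0; apply: mulr_gt0.
have f0 n (G : sgraph n) : 0 <= f n G.
  by rewrite mulr_ge0 ?(ltW a0)// sumr_ge0// => k _; rewrite sqr_ge0.
have f1 n (G : sgraph n) : (0 < n)%N ->
    ~~ (`|n%:R `^ (- (3 / 2)) * energy R G
      - 8 / (3 * pi) * Num.sqrt (p n * (1 - p n))| <= eps) -> 1 <= f n G.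
  move=> n0; rewrite -ltNge => lt_eps.
  have dev := energy_deviation_le G n0 (ltn0Sn _ : (0 < N)%N) h0 (hp n).
  (* The deviation is linear in the defects but only their second moments are controlled, hence x <=
     delta + x^2 / delta. *)
  have amgm k : self_consistency_defect (p n) (k.+1%:R * h) G <=
      delta + self_consistency_defect (p n) (k.+1%:R * h) G ^+ 2 / delta.
    move: (self_consistency_defect _ _ _) => x; rewrite -(ler_pM2r delta0) mulrDl divfK ?gt_eqF//.
    by have := sqr_ge0 (x - delta); have := sqr_ge0 (x + delta); nra.
  have : h * \sum_(k < N) self_consistency_defect (p n) (k.+1%:R * h) G <=
      eps / 4 + h / delta * \sum_(k < N) self_consistency_defect (p n) (k.+1%:R * h) G ^+ 2.
    rewrite (le_trans (ler_wpM2l (ltW h0) (ler_sum _ (fun (k : 'I_N) _ => amgm k))))//.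
    rewrite big_split /= sumr_const card_ord -mulr_suml mulrDr.
    have -> : h * (delta *+ N) = eps / 4.
      by rewrite -[delta *+ N]mulr_natl /delta; field; rewrite !gt_eqF.
    by rewrite lerD2l mulrA mulrAC.
  rewrite /f; set S := \sum_(k < N) _ ^+ 2 => le_S.
  have : eps / 2 <= h / delta * S by lra.
  have -> : 2 * h / (eps * delta) * S = h / delta * S * (2 / eps).
    by field; rewrite !gt_eqF.
  by rewrite mulrA ler_pdivlMr// mul1r; lra.
have Ef n : (0 < n)%N ->
    \sum_(G : sgraph n) Gnp_weight (p n) G * f n G <= K / Num.sqrt n%:R.
  move=> n0; rewrite /f /K.
  under eq_bigr do rewrite mulrCA mulr_sumr.
  rewrite -mulr_sumr exchange_big /= -[leRHS]mulrA ler_pM2l// mulr_suml.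
  apply: ler_sum => k _; apply: expectation_defect_le => //.
  by rewrite mulr_gt0// ltr0Sn.
have K0 : 0 <= K.
  rewrite mulr_ge0 ?(ltW a0)// sumr_ge0// => k _.
  by rewrite defect_constant_ge0// mulr_gt0// ltr0Sn.
apply/cvgrPdist_le => e e0.
(* For n >= M this gives sqrt n >= K / e, and the successor ensures n > 0. *)
pose M := (Num.truncn ((K / e) ^+ 2)).+1.
exists M => // n /= Mn.
have n0 : (0 < n)%N by exact: leq_trans Mn.
have /andP[lo up] := Gnp_markov (hp n) (f0 n) (fun G => f1 n G n0).
rewrite ger0_norm ?subr_ge0// lerBlDr -lerBlDl.
have nR : 0 < Num.sqrt n%:R :> R by rewrite sqrtr_gt0 ltr0n.
have : K / Num.sqrt n%:R <= e.
  rewrite ler_pdivrMr// mulrC -ler_pdivrMr//.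
  have Ke0 : 0 <= K / e by rewrite divr_ge0// ltW.
  rewrite -(@ler_pXn2r _ 2)// ?nnegrE ?sqrtr_ge0// sqr_sqrtr ?ler0n//.
  by rewrite ltW// (lt_le_trans (truncnS_gt _))// ler_nat.
by have := Ef n n0; lra.
Qed.
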